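(* Let $V$ be a nonzero finite-dimensional vector space over $\mathbb K$ and let $A,A^*$ be a tridiagonal pair on $V$. Let $\theta_0,\dots,\theta_d$ (resp. $\theta^*_0,\dots,\theta^*_d$) be a standard ordering of the eigenvalues of $A$ (resp. $A^*$). Assume there exist nonzero scalars $a,a^*\in\mathbb K$ such that $\theta_i=aq^{2i-d}$ and $\theta^*_i=a^*q^{d-2i}$ for $0\le i\le d$. Then there exists a unique $\mathcal U$-module structure on $V$ such that $ay^-_1$ acts as $A$ and $a^*y^-_0$ acts as $A^*$. Moreover there exists a unique $\mathcal U$-module structure on $V$ such that $ay^+_0$ acts as $A$ and $a^*y^+_1$ acts as $A^*$. Both $\mathcal U$-module structures are irreducible.
   Context: $\mathbb K$ is an algebraically closed field and $q\in\mathbb K$ is nonzero and not a root of unity; $[3]_q=\frac{q^3-q^{-3}}{q-q^{-1}}$. $\mathcal U$ denotes the unital associative $\mathbb K$-algebra (isomorphic to the quantum affine algebra $U_q(\widehat{sl}_2)$) with generators $y^{\pm}_i,k_i^{\pm1}$ ($i\in\{0,1\}$) and relations: $k_ik_i^{-1}=k_i^{-1}k_i=1$; $k_0k_1$ is central; $\frac{qy^+_ik_i-q^{-1}k_iy^+_i}{q-q^{-1}}=1$; $\frac{qk_iy^-_i-q^{-1}y^-_ik_i}{q-q^{-1}}=1$; $\frac{qy^-_iy^+_i-q^{-1}y^+_iy^-_i}{q-q^{-1}}=1$; $\frac{qy^+_iy^-_j-q^{-1}y^-_jy^+_i}{q-q^{-1}}=k_0^{-1}k_1^{-1}$ for $i\neq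 j$; $(y^{\pm}_i)^3y^{\pm}_j-[3]_q(y^{\pm}_i)^2y^{\pm}_jy^{\pm}_i+[3]_qy^{\pm}_iy^{\pm}_j(y^{\pm}_i)^2-y^{\pm}_j(y^{\pm}_i)^3=0$ for $i\neq j$. A tridiagonal pair on $V$ is an ordered pair $A,A^*$ of linear maps $V\to V$ such that: (i) each of $A,A^*$ is diagonalizable; (ii) there is an ordering $V_0,\dots,V_d$ of the eigenspaces of $A$ with $A^*V_i\subseteq V_{i-1}+V_i+V_{i+1}$ for $0\le i\le d$ (where $V_{-1}=V_{d+1}=0$); (iii) there is an ordering $V^*_0,\dots,V^*_\delta$ of the eigenspaces of $A^*$ with $AV^*_i\subseteq V^*_{i-1}+V^*_i+V^*_{i+1}$ for $0\le i\le\delta$ (where $V^*_{-1}=V^*_{\delta+1}=0$); (iv) there is no subspace $W$ with $AW\subseteq W$, $A^*W\subseteq W$, $W\ne0$, $W\neq V$. It is known that $d=\delta$. An ordering of the eigenspaces of $A$ (resp. $A^*$) satisfying (ii) (resp. (iii)) is called standard; an ordering of the eigenvalues is standard if the corresponding ordering of eigenspaces is standard. *)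

(* Defs.v *)
From HB Require Import structures.
From mathcomp Require Import all_boot all_order all_algebra.
Set Implicit Arguments. Unset Strict Implicit. Unset Printing Implicit Defensive.
Import Order.TTheory GRing.Theory Num.Theory.
Local Open Scope ring_scope.
Local Open Scope vspace_scope.
Import passmx.

Section Defs.
Variable K : fieldType.
Variable V : vectType K.

Local Open Scope lfun_scope.

Definition diagonalizable (f : 'End(V)) : Prop :=
  exists s : seq K, (\sum_(a <- s) leigenspace f a)%VS = fullv.

Definition esp (f : 'End(V)) (th : seq K) (i : nat) : {vspace V} :=
  if (i < size th)%N then leigenspace f th`_i else 0%VS.

Definition esp_prev (f : 'End(V)) (th : seq K) (i : nat) : {vspace V} :=
  if i is j.+1 then esp f th j else 0%VS.

Definition standard_ordering (f g : 'End(V)) (th : seq K) : Prop :=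
  [/\ uniq th,
      (forall i, (i < size th)%N -> leigenvalue f th`_i),
      (forall a, leigenvalue f a -> a \in th) &
      (forall i, (i < size th)%N ->
         (g @: esp f th i <= esp_prev f th i + esp f th i + esp f th i.+1)%VS)].

Definition tridiagonal_pair (A As : 'End(V)) : Prop :=
  [/\ diagonalizable A, diagonalizable As,
      (exists th, standard_ordering A As th),
      (exists ths, standard_ordering As A ths) &
      (forall W : {vspace V}, (A @: W <= W)%VS -> (As @: W <= W)%VS ->
         W = 0%VS \/ W = fullv)].

(* An action of the generators y^+_i, y^-_i, k_i, k_i^{-1} (i in 'I_2) of U *)
Record Uact := MkUact {
  yp : {ffun 'I_2 -> 'End(V)};
  ym : {ffun 'I_2 -> 'End(V)};
  kk : {ffun 'I_2 -> 'End(V)};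
  kinv : {ffun 'I_2 -> 'End(V)} }.

Definition q3 (q : K) : K := ((q ^+ 3 - q^-1 ^+ 3) / (q - q^-1))%R.

Definition serre (q : K) (y : 'I_2 -> 'End(V)) (i j : 'I_2) : Prop :=
  (y i \o y i \o y i \o y j) - q3 q *: (y i \o y i \o y j \o y i)
  + q3 q *: (y i \o y j \o y i \o y i) - (y j \o y i \o y i \o y i) = 0%R.

(* u defines a U-module structure on V: the generators act satisfying
   exactly the defining relations of U. *)
Definition is_Umodule (q : K) (u : Uact) : Prop :=
  let c := kk u ord0 \o kk u ord_max in
  let sc := ((q - q^-1)^-1)%R in
  [/\ forall i, kk u i \o kinv u i = \1%VF /\ kinv u i \o kk u i = \1%VF,
      forall i, [/\ c \o yp u i = yp u i \o c, c \o ym u i = ym u i \o c,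
                    c \o kk u i = kk u i \o c & c \o kinv u i = kinv u i \o c],
      [/\ forall i, sc *: (q *: (yp u i \o kk u i) - q^-1 *: (kk u i \o yp u i)) = \1%VF,
      forall i, sc *: (q *: (kk u i \o ym u i) - q^-1 *: (ym u i \o kk u i)) = \1%VF,
      forall i, sc *: (q *: (ym u i \o yp u i) - q^-1 *: (yp u i \o ym u i)) = \1%VF &
      forall i j, i != j ->
        sc *: (q *: (yp u i \o ym u j) - q^-1 *: (ym u j \o yp u i))
          = kinv u ord0 \o kinv u ord_max] &
      forall i j, i != j -> serre q (yp u) i j /\ serre q (ym u) i j].

Definition Uirreducible (u : Uact) : Prop :=
  (0 < \dim (fullv : {vspace V}))%N /\
  forall W : {vspace V},
    (forall i, [/\ (yp u i @: W <= W)%VS, (ym u i @: W <= W)%VS,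
                   (kk u i @: W <= W)%VS & (kinv u i @: W <= W)%VS]) ->
    W = 0%VS \/ W = fullv.

End Defs.

(* Main.v *)
(* Put X = A / a and Y = As / as_. Partial sums of the eigenspaces of X (of Y),
   taken in increasing or decreasing order, give flags Xl, Xg (Yl, Yg). Two flags
   F, G that are opposite (F_i and G_(d+1-i) are complementary) define the
   operator [F,G] acting as e_i = q^(2i-d) on F_(i+1) :&: G_(d+1-i); thus
   X = [Xl,Xg] and Y = [Yl,Yg]. By irreducibility flags of X and Y are opposite,
   and the missing generators must be k_1 = [Xg,Yg], k_0 = [Yg,Xg],
   y^+_1 = [Yg,Xl] and y^+_0 = [Xg,Yl].
   If M = [F,G] and N = [H,F], then q M N - q^-1 N M = q - q^-1 holds iff N moves
   G up by at most one step, iff M moves H up by at most one step. All the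
   quadratic relations of U have this shape. The cubic q-Serre relation holds for
   M = [F,G] and N as soon as N moves both F and G up by at most one step.
   The second module structure is the first one for q^-1, since exchanging
   y^+ and y^- turns the relations for q into those for q^-1. *)
Require Import Defs.
From HB Require Import structures.
From mathcomp Require Import all_boot all_order all_algebra.
From mathcomp Require Import zify ring.
Import GRing.Theory.
Local Open Scope ring_scope.
Set Implicit Arguments. Unset Strict Implicit. Unset Printing Implicit Defensive.

(** * Flags, opposite pairs of flags, and the operators they define *)

Section Flags.
Variables (K : fieldType) (V : vectType K) (d : nat).
Implicit Types (F G H : nat -> {vspace V}) (M N : 'End(V)) (mu nu : nat -> K).

(* Only the terms F 0, ..., F d.+1 matter: beyond them a flag is constantly fullv. *)
Definition is_flag F : Prop :=
  [/\ F 0%N = 0%VS, {homo F : i j / (i <= j)%N >-> (i <= j)%VS} & F d.+1 = fullv].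

Definition opposite F G : Prop :=
  forall i j, (i + j = d.+1)%N -> (F i :&: G j)%VS = 0%VS /\ (F i + G j)%VS = fullv.

(** [M] acts on the quotient F(i+1)/F(i) as the scalar [mu i]. For a flag this constrains only i <=
    d, since F(i) is the whole space from d+1 on. *)
Definition lowers M F mu : Prop :=
  forall i v, v \in F i.+1 -> M v - mu i *: v \in F i.

Definition raises M F : Prop := forall i v, v \in F i -> M v \in F i.+1.

Definition acts M F G mu : Prop :=
  forall i j v, (i + j = d)%N -> v \in F i.+1 -> v \in G j.+1 -> M v = mu i *: v.

Lemma flag_le F i j v : is_flag F -> (i <= j)%N -> v \in F i -> v \in F j.
Proof. by case=> _ FS _ /FS/subvP; apply. Qed.

Lemma flag_leS F i v : is_flag F -> v \in F i -> v \in F i.+1.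
Proof. by move=> fF; apply: flag_le. Qed.

Lemma flag0 F v : is_flag F -> v \in F 0%N -> v = 0.
Proof. by case=> -> _ _; rewrite memv0 => /eqP. Qed.

Lemma flagT F i v : is_flag F -> (d < i)%N -> v \in F i.
Proof. by move=> fF ltdi; apply: flag_le ltdi _ => //; case: fF => _ _ ->; apply: memvf. Qed.

Lemma opposite_sym F G : opposite F G -> opposite G F.
Proof. by move=> op i j ij; rewrite capvC addvC; apply: op; rewrite addnC. Qed.

Lemma opposite_eq0 F G i j v : is_flag F -> opposite F G ->
  (i + j <= d.+1)%N -> v \in F i -> v \in G j -> v = 0.
Proof.
move=> fF op leij Fv Gv; apply/eqP; rewrite -memv0.
have [| <- _] := op (d.+1 - j)%N j; first by lia.
rewrite memv_cap Gv andbT; apply: flag_le Fv => //; lia.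
Qed.

Lemma opposite_split F G i j v : is_flag F -> opposite F G -> (i + j = d)%N ->
  v \in F i.+1 -> exists2 u, v - u \in F i & u \in F i.+1 /\ u \in G j.+1.
Proof.
move=> fF op ij Fv; have [|_ sumT] := op i j.+1; first by lia.
have /memv_addP[f Ff [g Gg Dv]] : v \in (F i + G j.+1)%VS by rewrite sumT memvf.
exists g; first by rewrite Dv addrK.
split=> //; have -> : g = v - f by rewrite Dv addrC addKr.
by rewrite rpredB //; apply: flag_le Ff.
Qed.

(** Opposite flags decompose the space into the weight spaces F(i+1) :&: G(j+1) with i + j = d, and
    F(i) is the sum of the first i of them. It is therefore enough to treat weight vectors and
    sums. *)
Lemma opposite_ind F G (P : nat -> V -> Prop) : is_flag F -> opposite F G ->
    (P 0%N 0) -> (forall i v w, P i v -> P i.+1 w -> P i.+1 (v + w)) ->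
    (forall i j u, (i + j = d)%N -> u \in F i.+1 -> u \in G j.+1 -> P i.+1 u) ->
  forall i v, (i <= d.+1)%N -> v \in F i -> P i v.
Proof.
move=> fF op P0 PD PU; elim=> [|i IHi] v lei Fv; first by rewrite (flag0 fF Fv).
have [|u Fvu [Fu Gu]] := @opposite_split F G i (d - i) v fF op _ Fv; first by lia.
rewrite -(subrK u v); apply: PD; first by apply: IHi => //; lia.
by apply: PU Fu Gu; lia.
Qed.

Lemma opposite_ext F G M N : is_flag F -> opposite F G ->
    (forall i j u, (i + j = d)%N -> u \in F i.+1 -> u \in G j.+1 -> M u = N u) ->
  M = N.
Proof.
move=> fF op eqMN; apply/lfunP => v.
apply: (@opposite_ind F G (fun _ v => M v = N v)) (leqnn d.+1) _ => //.
- by rewrite !linear0.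
- by move=> _ u w; rewrite !linearD /= => -> ->.
- by apply: flagT.
Qed.

Lemma acts_unique F G M N mu : is_flag F -> opposite F G ->
  acts M F G mu -> acts N F G mu -> M = N.
Proof.
move=> fF op aM aN; apply: (opposite_ext fF op) => i j u ij Fu Gu.
by rewrite (aM i j) // (aN i j).
Qed.

Lemma lowers_stable F M mu i v : is_flag F -> lowers M F mu -> v \in F i -> M v \in F i.
Proof.
move=> fF lM; case: i => [|i] Fv.
  by rewrite (flag0 fF Fv) linear0 rpred0.
rewrite -(subrK (mu i *: v) (M v)) rpredD ?rpredZ //.
by apply: flag_le (lM _ _ Fv).
Qed.

Lemma stable_subZ F M i a v : (forall i v, v \in F i -> M v \in F i) ->
  v \in F i -> M v - a *: v \in F i.
Proof. by move=> sM Fv; rewrite rpredB ?rpredZ ?sM. Qed.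

(** On a weight vector v, M v - mu_i v lies in F(i) :&: G(j+1), which is 0 because the two indices
    add up to d+1. *)
Lemma lowers_acts F G M mu : is_flag F -> opposite F G ->
  lowers M F mu -> (forall i v, v \in G i -> M v \in G i) -> acts M F G mu.
Proof.
move=> fF op lM sM i j v ij Fv Gv; apply/eqP; rewrite -subr_eq0; apply/eqP.
by apply: (@opposite_eq0 F G i j.+1) => //; [lia | apply: lM | apply: stable_subZ].
Qed.

Lemma acts_lowers F G M mu : is_flag F -> opposite F G ->
  acts M F G mu -> lowers M F mu.
Proof.
move=> fF op aM; elim=> [|i IHi] v Fv.
  have Gv : v \in G d.+1.
    have [_] := op 0%N d.+1 erefl; case: fF => -> _ _.
    by rewrite add0v => ->; rewrite memvf.
  by rewrite (aM 0%N d) // subrr rpred0.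
case: (leqP i.+1 d) => [lei|]; last by move=> ?; apply: flagT.
have [|u Fvu [Fu Gu]] := @opposite_split F G i.+1 (d - i.+1) v fF op _ Fv.
  by lia.
have Mu : M u - mu i.+1 *: u = 0 by rewrite (aM i.+1 (d - i.+1)%N) ?subrr //; lia.
rewrite -(subrK u v) linearD scalerDr opprD addrACA Mu addr0.
rewrite rpredB ?rpredZ //.
have Fw : M (v - u) - mu i *: (v - u) \in F i.+1 by apply: flag_le (IHi _ Fvu).
by have := rpredD Fw (rpredZ (mu i) Fvu); rewrite subrK.
Qed.

Lemma acts_exist F G mu : is_flag F -> is_flag G -> opposite F G ->
  exists M, acts M F G mu.
Proof.
move=> fF fG op.
(* [P i] projects onto F(i) along G(d+1-i), so [P i.+1 - P i] is the projection onto the i-th weight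
   space. *)
pose P i := daddv_pi (F i) (G (d.+1 - i)%N).
exists (\sum_(i < d.+1) mu i *: (P i.+1 - P i)) => i j v ij Fv Gv.
have Pge k : (i < k <= d.+1)%N -> P k v = v.
  move=> lek; apply: daddv_pi_id; first by have [|->] := op k (d.+1 - k)%N; first lia.
  by apply: flag_le Fv => //; lia.
have Ple k : (k <= i)%N -> P k v = 0.
  move=> lek; have [|cap sumT] := op k (d.+1 - k)%N; first lia.
  have := daddv_pi_add cap (w := v); rewrite sumT memvf => /(_ isT).
  rewrite [X in _ + X]daddv_pi_id ?(capvC _ (F _)) //; last by apply: flag_le Gv => //; lia.
  by move/(canRL (addrK _)); rewrite subrr.
have ltid : (i < d.+1)%N by lia.
rewrite sum_lfunE (bigD1 (Ordinal ltid)) //= big1 => [|k nek].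
  by rewrite addr0 scale_lfunE add_lfunE opp_lfunE Pge ?Ple ?subr0 ?ltnSn.
rewrite scale_lfunE add_lfunE opp_lfunE.
have ltk := ltn_ord k.
have [ltki|leik] := ltnP k i; first by rewrite !Ple ?subr0 ?scaler0 // ltnW.
have ltik : (i < k)%N by rewrite ltn_neqAle leik andbT eq_sym.
by rewrite !Pge ?subrr ?scaler0 //; lia.
Qed.

(** [l] differs from the scalars of M on all quotients between F(i) and F(j), so the class of v
    vanishes in each of them, from the top down. *)
Lemma eigenvector_lowers F M mu l i j v : lowers M F mu -> M v = l *: v ->
  (i <= j)%N -> (forall k, (i <= k < j)%N -> mu k != l) -> v \in F j -> v \in F i.
Proof.
move=> lM Mv; elim: j => [|j IHj] leij neq Fv; first by case: i leij {neq}.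
have [-> //|ltij] : i = j.+1 \/ (i <= j)%N by lia.
apply: IHj => // [k leik|]; first by apply: neq; lia.
have := lM _ _ Fv; rewrite Mv -scalerBl => Fv'.
have nz : l - mu j != 0 by rewrite subr_eq0 eq_sym neq //; lia.
by rewrite -[v](scalerK nz) rpredZ.
Qed.

(** By induction (M - mu_i) v, which lies in F(i) and in G(j), is 0. So v is an eigenvector whose
    eigenvalue mu_i differs from every scalar of M on G(j), and it descends to G(0) = 0. *)
Lemma disjoint_spectra F G M mu nu : is_flag F -> is_flag G ->
    lowers M F mu -> lowers M G nu ->
    (forall i j, (i + j < d)%N -> mu i != nu j) ->
  forall i j v, (i + j <= d.+1)%N -> v \in F i -> v \in G j -> v = 0.
Proof.
move=> fF fG lF lG neq; elim=> [|i IHi] j v leij Fv Gv; first exact: flag0 Fv.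
have Mv : M v = mu i *: v.
  apply/eqP; rewrite -subr_eq0; apply/eqP/(IHi j); [lia | exact: lF |].
  by apply: stable_subZ Gv => k w; apply: lowers_stable lG.
apply: (flag0 fG); apply: (eigenvector_lowers lG Mv (leq0n j)) Gv => k ltkj.
by rewrite eq_sym neq //; lia.
Qed.

(* The span of the F i :&: G (s - i), i <= s, is stable under both maps. For
   s = d + 1 it is proper, hence 0; for s = d + 2 it contains F 1, hence is V. *)
Lemma irreducible_opposite F G M N mu nu : is_flag F -> is_flag G ->
    lowers M G mu -> raises N G -> lowers N F nu -> raises M F ->
    F 1%N != 0%VS -> G d != fullv ->
    (forall W : {vspace V}, (M @: W <= W)%VS -> (N @: W <= W)%VS ->
       W = 0%VS \/ W = fullv) ->
  opposite F G.
Proof.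
move=> fF fG lM rN lN rM F1 Gd irr.
pose W s := (\sum_(i < s.+1) (F i :&: G (s - i)%N))%VS.
have WS s i v : (i <= s)%N -> v \in F i -> v \in G (s - i)%N -> v \in W s.
  move=> leis Fv Gv; have ltis : (i < s.+1)%N by [].
  apply: subvP (sumv_sup (Ordinal ltis) isT (subvv _)) _ _.
  by rewrite memv_cap Fv.
have stab s (P : 'End(V)) : (forall i v, (i <= s)%N -> v \in F i ->
    v \in G (s - i)%N -> P v \in W s) -> (P @: W s <= W s)%VS.
  move=> PW; apply/subvP => _ /memv_imgP[v /memv_sumP[vs vsW ->] ->].
  rewrite linear_sum rpred_sum //= => i _.
  have /memv_capP[Fv Gv] := vsW i isT.
  by apply: PW Fv Gv; have := ltn_ord i; lia.
(* [M] sends the term of index i into the terms i and i+1 of [W s], and [N] sends it into the terms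
   i and i-1. *)
have Wirr s : W s = 0%VS \/ W s = fullv.
  apply: irr; apply: stab => i v leis Fv Gv.
    have [E|ltis] : (s - i)%N = 0%N \/ (i < s)%N by lia.
      by rewrite E in Gv; rewrite (flag0 fG Gv) linear0 rpred0.
    have E : (s - i)%N = (s - i.+1).+1 by lia.
    rewrite E in Gv.
    rewrite -(subrK (mu (s - i.+1)%N *: v) (M v)) rpredD //; last first.
      by rewrite rpredZ //; apply: (WS _ i) => //; rewrite E.
    apply: (WS _ i.+1) => //; last exact: lM.
    rewrite rpredB ?rM // rpredZ //; exact: flag_le Fv.
  case: i leis Fv Gv => [|i] leis Fv Gv.
    by rewrite (flag0 fF Fv) linear0 rpred0.
  rewrite -(subrK (nu i *: v) (N v)) rpredD //; last first.
    by rewrite rpredZ //; apply: (WS _ i.+1).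
  apply: (WS _ i); [lia | exact: lN |].
  have -> : (s - i = (s - i.+1).+1)%N by lia.
  rewrite rpredB ?rN // rpredZ //; exact: flag_le Gv.
(* All terms of [W d.+1] lie in the proper subspace G(d); the one of index 0 does because F(0) =
   0. *)
have W0 : W d.+1 = 0%VS.
  have [//|WT] := Wirr d.+1; case/negP: Gd.
  rewrite eqEsubv subvf /= -WT; apply/subv_sumP => i _.
  apply/subvP => v /memv_capP[Fv Gv].
  case: (unliftP ord0 i) Fv Gv => [i' ->|->] Fv Gv.
    by apply: flag_le Gv => //; rewrite lift0; lia.
  by rewrite (flag0 fF Fv) rpred0.
have W1 : W d.+2 = fullv.
  have [W0'|//] := Wirr d.+2; case/negP: F1.
  rewrite -subv0 -W0'; apply/subvP => v Fv; apply: (WS _ 1%N) => //.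
  by apply: flagT fG _; lia.
move=> i j ij; split; apply/eqP.
  rewrite -subv0 -W0; apply/subvP => v /memv_capP[Fv Gv].
  by apply: (WS _ i) => //; [lia | have -> : (d.+1 - i = j)%N by lia].
(* A term F(k) :&: G(d+2-k) lies in F(i) if k <= i, and in G(j) otherwise, since then d+2-k <= j. *)
rewrite eqEsubv subvf -W1 /=; apply/subv_sumP => k _.
have := ltn_ord k => ltk.
apply/subvP => v /memv_capP[Fv Gv]; have [leki|ltik] := leqP k i.
  by apply: subvP (addvSl _ _) _ _; apply: flag_le Fv.
by apply: subvP (addvSr _ _) _ _; apply: flag_le Gv => //; lia.
Qed.

End Flags.

(** * The relation q M N - q^-1 N M = q - q^-1 *)

Definition qweyl (K : fieldType) (V : vectType K) (q : K) (M N : 'End(V)) : Prop :=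
  ((q - q^-1)^-1 *: (q *: (M \o N) - q^-1 *: (N \o M)) = \1)%VF.

(** The scalar q^(2i-d), written with natural exponents only. *)
Definition weight (K : fieldType) (q : K) (d i : nat) : K := q ^+ (2 * i) / q ^+ d.

Lemma qbracketV (K : fieldType) (V : vectType K) (q : K) (M N : 'End(V)) :
  ((q^-1 - q^-1^-1)^-1 *: (q^-1 *: (M \o N) - q^-1^-1 *: (N \o M)) =
   (q - q^-1)^-1 *: (q *: (N \o M) - q^-1 *: (M \o N)))%VF.
Proof. by rewrite invrK -(opprB q) invrN scaleNr -scalerN opprB. Qed.

Section QWeyl.
Variables (K : fieldType) (q : K).
Hypotheses (q0 : q != 0) (qroot : forall n, (0 < n)%N -> q ^+ n != 1).
Variables (V : vectType K) (d : nat).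
Implicit Types (F G H : nat -> {vspace V}) (M N : 'End(V)).

Local Notation wt := (weight q d).
Local Notation iwt := (fun i => (wt i)^-1).

Lemma sub_qV_neq0 : q - q^-1 != 0.
Proof.
apply: contraNneq (qroot (isT : 0 < 2)%N) => /eqP; rewrite subr_eq0 => /eqP E.
by rewrite expr2 {2}E divff.
Qed.

Lemma wt_neq0 i : wt i != 0.
Proof. by rewrite mulf_neq0 ?invr_neq0 ?expf_neq0. Qed.

Lemma wtS i : wt i.+1 = q ^+ 2 * wt i.
Proof. by rewrite /weight mulnS exprD mulrA. Qed.

Lemma wt_eq i j : (wt i == wt j) = (i == j).
Proof.
apply/eqP/eqP => [|-> //]; wlog ltij : i j / (i < j)%N => [IH|].
  by case: (ltngtP i j) => // lt E; [apply: IH | apply/esym/IH].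
move/(mulIf (invr_neq0 (expf_neq0 d q0))).
rewrite -{1}(subnKC (ltnW ltij)) mulnDr exprD -[LHS]mulr1.
move/(mulfI (expf_neq0 _ q0))/esym/eqP; rewrite (negPf (qroot _)) //; lia.
Qed.

Lemma wtC i j : (i + j = d)%N -> wt j = (wt i)^-1.
Proof.
move=> ij; rewrite /weight invf_div -ij.
apply/eqP; rewrite eqr_div ?expf_neq0 // -!exprD; apply/eqP; congr (_ ^+ _); lia.
Qed.

Lemma wtV i : weight q^-1 d i = (wt i)^-1.
Proof. by rewrite /weight !exprVn invf_div invrK mulrC. Qed.

Lemma qweylP M N : qweyl q M N <->
  forall v, q *: M (N v) - q^-1 *: N (M v) = (q - q^-1) *: v.
Proof.
have h0 := sub_qV_neq0; split=> [MN v|MN].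
  have /lfunP/(_ v) := MN; rewrite !lfun_simp => /= E.
  by rewrite -[in RHS]E scalerA divff ?scale1r.
by apply/lfunP => v; rewrite !lfun_simp /= MN scalerA mulVf ?scale1r.
Qed.

(** The relation gives M N v = (l/q^2) N v + (1 - q^-2) v, and subtracting v/l from N v absorbs the
    second term. *)
Lemma qweyl_eigen M N l v : qweyl q M N -> l != 0 -> M v = l *: v ->
  M (N v - l^-1 *: v) = (l / q ^+ 2) *: (N v - l^-1 *: v).
Proof.
move/qweylP/(_ v) => MN l0 Mv.
have {}MN : M (N v) = (l / q ^+ 2) *: N v + (1 - (q ^+ 2)^-1) *: v.
  apply: (scalerI q0); move/(canRL (subrK _)): MN => ->.
  rewrite Mv [N (l *: v)]linearZ /= scalerDr !scalerA addrC; congr (_ *: _ + _ *: _).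
    by field.
  by field.
rewrite linearB /= [M (_ *: _)]linearZ /= MN Mv scalerBr !scalerA -addrA -scalerBl.
by rewrite -scaleNr; congr (_ + _ *: _); field; rewrite l0 q0.
Qed.

Lemma acts_swap F G M : acts d M F G wt -> acts d M G F iwt.
Proof. by move=> aM i j v ij Gv Fv; rewrite -(wtC ij); apply: aM => //; lia. Qed.

(** N v - v/wt(i) satisfies the eigenvector equation of M for wt(i)/q^2. This scalar is wt(i-1) if i
    > 0 and none of the weights if i = 0, so the vector descends to F(i) along F and to G(j+2) along
    G. *)
Lemma qweyl_acts F G M N i j v : is_flag d F -> is_flag d G -> opposite d F G ->
    acts d M F G wt -> qweyl q M N -> (i + j = d)%N ->
    v \in F i.+1 -> v \in G j.+1 ->
  N v - (wt i)^-1 *: v \in F i /\ N v - (wt i)^-1 *: v \in G j.+2.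
Proof.
move=> fF fG op aM MN ij Fv Gv.
have lMF := acts_lowers fF op aM.
have lMG := acts_lowers fG (opposite_sym op) (acts_swap aM).
have Mw := qweyl_eigen MN (wt_neq0 i) (aM i j v ij Fv Gv).
split.
  case: (leqP i d.+1) => lei; last by apply: flagT fF _; lia.
  apply: (eigenvector_lowers lMF Mw lei); last exact: flagT fF _.
  move=> k lek; apply/eqP => E.
  have /eqP : wt k.+1 = wt i by rewrite wtS E; field.
  by rewrite wt_eq; lia.
case: (leqP j.+2 d.+1) => lej; last by apply: flagT fG _; lia.
apply: (eigenvector_lowers lMG Mw lej); last exact: flagT fG _.
move=> k lek; apply/eqP => E.
have kd : (d - k + k = d)%N by lia.
have /eqP : wt (d - k).+1 = wt i.
  rewrite wtS -[wt (d - k)%N]invrK -(wtC kd) E; field; exact: q0.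
by rewrite wt_eq; lia.
Qed.

Lemma qweyl_lowers F G M N : is_flag d F -> is_flag d G -> opposite d F G ->
  acts d M F G wt -> qweyl q M N -> lowers N F iwt.
Proof.
move=> fF fG op aM MN i v Fv.
have [ltdi|leid] := ltnP d i; first exact: flagT fF _.
(* The induction also carries N u in F(k), which settles the summand coming from one step lower. *)
pose P k u := [/\ u \in F k, N u \in F k & forall i, k = i.+1 -> N u - iwt i *: u \in F i].
suff [_ _ /(_ i erefl)] : P i.+1 v by [].
apply: (@opposite_ind _ _ d F G P) Fv => //.
- by split=> //; rewrite ?linear0 rpred0.
- move=> k u w [Fu FNu _] [Fw FNw Pw]; split=> [||_ [<-]].
  + by rewrite rpredD //; exact: flag_leS fF Fu.
  + by rewrite linearD rpredD //; exact: flag_leS fF FNu.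
  + rewrite linearD scalerDr opprD addrACA rpredD ?Pw //.
    by rewrite rpredB ?rpredZ.
- move=> k j u kj Fu Gu; have [Fw _] := qweyl_acts fF fG op aM MN kj Fu Gu.
  split=> // [|_ [<-] //].
  by rewrite -(subrK (iwt k *: u) (N u)) rpredD ?rpredZ //; exact: flag_leS fF Fw.
Qed.

Lemma qweyl_raises F G M N : is_flag d F -> is_flag d G -> opposite d F G ->
  acts d M F G wt -> qweyl q M N -> raises N G.
Proof.
move=> fF fG op aM MN i v Gv.
have [ltdi|leid] := ltnP d i; first by apply: flagT fG _; lia.
apply: (@opposite_ind _ _ d G F (fun k u => N u \in G k.+1)) Gv => //.
- exact: opposite_sym.
- by rewrite linear0 rpred0.
- move=> k u w Gu Gw; rewrite linearD rpredD //; exact: flag_leS fG Gu.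
- move=> j k u jk Gu Fu; have kj : (k + j = d)%N by lia.
  have [_ Gw] := qweyl_acts fF fG op aM MN kj Fu Gu.
  rewrite -(subrK (iwt k *: u) (N u)) rpredD ?rpredZ //; exact: flag_leS fG Gu.
- exact: leqW.
Qed.

(** For a weight vector v of index i, N v - v/wt(i) lies in F(i) :&: G(j+2). This is the weight
    space of index i-1, or 0 if i = 0, so M acts there as wt(i)/q^2 and the relation at v
    follows. *)
Lemma qweyl_of_raises F G M N : is_flag d F -> is_flag d G -> opposite d F G ->
  acts d M F G wt -> lowers N F iwt -> raises N G -> qweyl q M N.
Proof.
move=> fF fG op aM lN rN; apply/qweylP.
suff E : (q *: (M \o N) - q^-1 *: (N \o M))%VF = ((q - q^-1) *: \1)%VF.
  by move=> v; have /lfunP/(_ v) := E; rewrite !lfun_simp.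
apply: (opposite_ext fF op) => i j v ij Fv Gv; rewrite !lfun_simp /=.
rewrite (aM i j v) // [N (_ *: v)]linearZ /=.
have Fw := lN _ _ Fv; have Gw : N v - iwt i *: v \in G j.+2.
  by rewrite rpredB ?rN // rpredZ //; exact: flag_leS fG Gv.
have Mw : M (N v - iwt i *: v) = (wt i / q ^+ 2) *: (N v - iwt i *: v).
  case: i ij Fv Fw Gw => [|i] ij Fv Fw Gw.
    by rewrite (flag0 fF Fw) linear0 scaler0.
  rewrite (aM i j.+1) //; last by lia.
  by rewrite wtS; congr (_ *: _); field.
have nz := wt_neq0 i.
have MN : M (N v) = (wt i / q ^+ 2) *: N v + (1 - (q ^+ 2)^-1) *: v.
  move: Mw; rewrite linearB /= [M (_ *: _)]linearZ /= (aM i j v) //.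
  move/(canRL (subrK _)) ->; rewrite scalerBr !scalerA -addrA.
  by rewrite -scaleNr -scalerDl; congr (_ + _ *: _); field; rewrite nz q0.
rewrite MN scalerDr !scalerA addrC addrA -scaleNr -scalerDl.
have -> : - (q^-1 * wt i) + q * (wt i / q ^+ 2) = 0 by field.
by rewrite scale0r add0r; congr (_ *: _); field.
Qed.

Lemma qweylV M N : qweyl q M N <-> qweyl q^-1 N M.
Proof. by rewrite /qweyl qbracketV. Qed.

End QWeyl.

(** * The same facts with M and N exchanged, obtained by passing to q^-1 *)

Section QWeylReversed.
Variables (K : fieldType) (q : K).
Hypotheses (q0 : q != 0) (qroot : forall n, (0 < n)%N -> q ^+ n != 1).
Variables (V : vectType K) (d : nat).
Implicit Types (F G H : nat -> {vspace V}) (M N : 'End(V)).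

Local Notation wt := (weight q d).
Local Notation iwt := (fun i => (wt i)^-1).

Let qV0 : q^-1 != 0. Proof. by rewrite invr_eq0. Qed.

Lemma qV_not_root n : (0 < n)%N -> q^-1 ^+ n != 1.
Proof. by move=> n0; rewrite exprVn invr_eq1 qroot. Qed.

Lemma acts_weightV F G M : acts d M G F wt -> acts d M F G (weight q^-1 d).
Proof.
move=> aM i j v ij Fv Gv; rewrite wtV (aM j i) //; last by lia.
by rewrite (wtC q0 ij).
Qed.

Lemma qweyl_lowers_l F H M N : is_flag d F -> is_flag d H -> opposite d H F ->
  acts d N H F wt -> qweyl q M N -> lowers M F wt.
Proof.
move=> fF fH op aN /qweylV MN i v Fv.
have := qweyl_lowers qV0 qV_not_root fF fH (opposite_sym op) (acts_weightV aN) MN Fv.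
by rewrite wtV invrK.
Qed.

Lemma qweyl_raises_l F H M N : is_flag d F -> is_flag d H -> opposite d H F ->
  acts d N H F wt -> qweyl q M N -> raises M H.
Proof.
move=> fF fH op aN /qweylV MN.
exact: (qweyl_raises qV0 qV_not_root fF fH (opposite_sym op) (acts_weightV aN) MN).
Qed.

Lemma qweyl_of_raises_l F H M N : is_flag d F -> is_flag d H -> opposite d H F ->
  acts d N H F wt -> lowers M F wt -> raises M H -> qweyl q M N.
Proof.
move=> fF fH op aN lM rM; apply/qweylV.
apply: (qweyl_of_raises qV0 qV_not_root fF fH (opposite_sym op) (acts_weightV aN)) rM.
by move=> i v Fv; rewrite wtV invrK; apply: lM.
Qed.

End QWeylReversed.

(** * Commuting maps, inverses and the q-Serre relation *)

Section FourFlags.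
Variables (K : fieldType) (q : K).
Hypotheses (q0 : q != 0) (qroot : forall n, (0 < n)%N -> q ^+ n != 1).
Variables (V : vectType K) (d : nat).
Implicit Types (F G H : nat -> {vspace V}) (M N : 'End(V)).

Local Notation wt := (weight q d).
Local Notation iwt := (fun i => (wt i)^-1).

(** [C] preserves the eigenvalue of an eigenvector of [M], and distinct eigenvalues bring the image
    back down to the right step of F. This serves for the central element k_0 k_1. *)
Lemma commute_stable F G M (C : 'End(V)) (mu : nat -> K) i v :
    is_flag d F -> is_flag d G -> opposite d F G -> acts d M F G mu ->
    (forall i j, (i < j)%N -> mu i != mu j) -> (C \o M = M \o C)%VF ->
  v \in F i -> C v \in F i.
Proof.
move=> fF fG op aM neq CM Fv.
have [ltdi|leid] := ltnP d i; first exact: flagT fF _.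
apply: (@opposite_ind _ _ d F G (fun k u => C u \in F k)) Fv => //.
- by rewrite linear0 rpred0.
- by move=> k u w Fu Fw; rewrite linearD rpredD //; apply: flag_leS fF Fu.
- move=> k j u kj Fu Gu; have MCu : M (C u) = mu k *: C u.
    by have /lfunP/(_ u) := CM; rewrite !comp_lfunE (aM k j) // linearZ => <-.
  have ltk : (k.+1 <= d.+1)%N by lia.
  apply: (eigenvector_lowers (acts_lowers fF op aM) MCu ltk).
    by move=> l /andP[ltkl _]; rewrite eq_sym neq.
  exact: flagT fF _.
- exact: leqW.
Qed.

(** [M] is injective, so by finite dimension it maps W onto itself. *)
Lemma inverse_stable M N (W : {vspace V}) v : (N \o M = \1)%VF ->
  (forall u, u \in W -> M u \in W) -> v \in W -> N v \in W.
Proof.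
move=> NM sM Wv; have NMu u : N (M u) = u by rewrite -comp_lfunE NM id_lfunE.
have MW : (M @: W)%VS = W.
  apply/eqP; rewrite eqEdim limg_dim_eq ?leqnn ?andbT.
    by apply/subvP => _ /memv_imgP[u Wu ->]; apply: sM.
  apply/eqP; rewrite -subv0; apply/subvP => u /memv_capP[_].
  by rewrite memv_ker memv0 => /eqP Mu; rewrite -(NMu u) Mu linear0.
by move: Wv; rewrite -{1}MW => /memv_imgP[u Wu ->]; rewrite NMu.
Qed.

Lemma q3E : q3 q = q ^+ 2 + 1 + (q ^+ 2)^-1.
Proof.
by apply: (mulIf (sub_qV_neq0 q0 qroot)); rewrite divfK ?sub_qV_neq0 //; field.
Qed.

(* On a weight vector v of M, of weight e, the Serre expression is
   (M - e / q^2) (M - e) (M - q^2 e) N v; the three factors push N v down the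
   flag F while keeping it in G, until it lands in F :&: G = 0. *)
Lemma serre_of_raises F G (y : 'I_2 -> 'End(V)) i j : is_flag d F -> is_flag d G ->
    opposite d F G -> acts d (y i) F G wt -> raises (y j) F -> raises (y j) G ->
  serre q y i j.
Proof.
rewrite /serre; move: (y i) (y j) => M N {y i j} fF fG op aM rF rG.
apply: (opposite_ext fF op) => i j v ij Fv Gv.
have lMF := acts_lowers fF op aM.
have lMG := acts_lowers fG (opposite_sym op) (acts_swap q0 aM).
have sG a u : u \in G j.+2 -> M u - a *: u \in G j.+2.
  by move=> Gu; apply: stable_subZ => // k w; apply: (lowers_stable fG lMG).
rewrite !lfun_simp /=.
set e := wt i; set p := N v.
have Fp : p \in F i.+2 by apply: rF.
have Gp : p \in G j.+2 by apply: rG.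
have := lMF _ _ Fp; have := sG (wt i.+1) _ Gp; rewrite wtS -/e.
set p1 := _ - _ => Gp1 Fp1.
have := lMF _ _ Fp1; have := sG e _ Gp1; rewrite -/e.
set p2 := _ - _ => Gp2 Fp2.
have Mp2 : M p2 = (e / q ^+ 2) *: p2.
  apply/eqP; rewrite -subr_eq0; apply/eqP.
  clear Fv Fp Fp1; case: i @e ij @p1 Gp1 @p2 Gp2 Fp2 => [|i] e ij p1 Gp1 p2 Gp2 Fp2.
    by rewrite (flag0 fF Fp2) linear0 scaler0 subrr.
  apply: (opposite_eq0 fF op _ _ (sG _ _ Gp2)); last first.
    suff -> : e / q ^+ 2 = wt i by apply: lMF.
    by rewrite /e wtS; field.
  by lia.
(* All vectors that occur lie in the span of [p2], [p1], [p], on which M is triangular. In the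
   coordinates of [L] the Serre relation becomes three identities in the field. *)
pose L (x2 x1 x0 : K) := x2 *: p2 + x1 *: p1 + x0 *: p.
have LD x2 x1 x0 y2 y1 y0 : L x2 x1 x0 + L y2 y1 y0 = L (x2 + y2) (x1 + y1) (x0 + y0).
  by rewrite /L !scalerDl [LHS]addrACA; congr (_ + _); apply: addrACA.
have LZ a x2 x1 x0 : a *: L x2 x1 x0 = L (a * x2) (a * x1) (a * x0).
  by rewrite /L !scalerDr !scalerA.
have LN x2 x1 x0 : - L x2 x1 x0 = L (- x2) (- x1) (- x0).
  by rewrite -scaleN1r LZ !mulN1r.
have MZ a u : M (a *: u) = a *: M u by rewrite linearZ.
have Mp : M p = L 0 1 (q ^+ 2 * e) by rewrite /L scale0r add0r scale1r subrK.
have Mp1 : M p1 = L 1 e 0 by rewrite /L scale0r addr0 scale1r subrK.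
clearbody p2; clearbody p1.
have ML x2 x1 x0 : M (L x2 x1 x0) =
    L (x2 * (e / q ^+ 2) + x1) (x1 * e + x0) (x0 * (q ^+ 2 * e)).
  rewrite {1}/L !linearD /= !MZ Mp2 Mp1 Mp.
  have -> : (e / q ^+ 2) *: p2 = L (e / q ^+ 2) 0 0 by rewrite /L !scale0r !addr0.
  by rewrite !LZ !LD; congr L; ring.
have Dp : p = L 0 0 1 by rewrite /L !scale0r !add0r scale1r.
have NZ a : N (a *: v) = a *: p by apply: linearZ.
have Mv : M v = e *: v by apply: (aM i j).
clearbody p; rewrite !(MZ, Mv, NZ, scalerA) Dp !(ML, LZ, LN, LD).
have <- : L 0 0 0 = 0 by rewrite /L !scale0r !addr0.
by rewrite q3E; congr L; field.
Qed.

(** * Existence and uniqueness of the action attached to four flags *)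

Variables (X Y : 'End(V)) (Xl Xg Yl Yg : nat -> {vspace V}).
Hypotheses (fXl : is_flag d Xl) (fXg : is_flag d Xg).
Hypotheses (fYl : is_flag d Yl) (fYg : is_flag d Yg).
Hypotheses (aX : acts d X Xl Xg wt) (aY : acts d Y Yl Yg wt).
Hypotheses (rXYl : raises X Yl) (rXYg : raises X Yg).
Hypotheses (rYXl : raises Y Xl) (rYXg : raises Y Xg).
Hypotheses (opX : opposite d Xl Xg) (opY : opposite d Yl Yg).
Hypotheses (opgg : opposite d Xg Yg) (opgl : opposite d Yg Xl) (oplg : opposite d Xg Yl).

(** Exchanging the two flags replaces i by d - i, hence inverts the weight. *)
Lemma acts_mul F G M N i j v : acts d M F G wt -> acts d N G F wt ->
  (i + j = d)%N -> v \in F i.+1 -> v \in G j.+1 -> M (N v) = v.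
Proof.
move=> aM aN ij Fv Gv; rewrite (aN j i) //; last by lia.
rewrite linearZ /= (aM i j) // scalerA (wtC q0 ij) mulVf ?scale1r //.
exact: wt_neq0.
Qed.

Lemma acts_inverse F G M N : is_flag d F -> opposite d F G ->
  acts d M F G wt -> acts d N G F wt -> (M \o N)%VF = \1%VF.
Proof.
move=> fF op aM aN; apply: (opposite_ext fF op) => i j v ij Fv Gv.
by rewrite comp_lfunE id_lfunE; apply: acts_mul Fv Gv.
Qed.

Lemma ord2P (P : 'I_2 -> Prop) : P ord0 -> P ord_max -> forall i, P i.
Proof.
move=> P0 P1 i; have [->//|i0] := eqVneq i ord0.
suff -> : i = ord_max by [].
by apply: val_inj; case: i i0 => [[|[|]]].
Qed.

Lemma Umodule_exists :
  exists u : Uact V, is_Umodule q u /\ ym u ord_max = X /\ ym u ord0 = Y.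
Proof.
have [k1 ak1] := acts_exist wt fXg fYg opgg.
have [k0 ak0] := acts_exist wt fYg fXg (opposite_sym opgg).
have [z az] := acts_exist wt fYg fXl opgl.
have [w aw] := acts_exist wt fXg fYl oplg.
have lX := acts_lowers fXl opX aX.
have lXg := acts_lowers fXg (opposite_sym opX) (acts_swap q0 aX).
have lY := acts_lowers fYl opY aY.
have lYg := acts_lowers fYg (opposite_sym opY) (acts_swap q0 aY).
have lk1 := acts_lowers fXg opgg ak1.
have lk0 := acts_lowers fYg (opposite_sym opgg) ak0.
have lz := acts_lowers fYg opgl az.
have lzX := acts_lowers fXl (opposite_sym opgl) (acts_swap q0 az).
have lw := acts_lowers fXg oplg aw.
have lwY := acts_lowers fYl (opposite_sym oplg) (acts_swap q0 aw).
have k1X : qweyl q k1 X by apply: qweyl_of_raises ak1 lXg rXYg.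
have k0Y : qweyl q k0 Y by apply: qweyl_of_raises ak0 lYg rYXg => //; apply: opposite_sym.
have Xz : qweyl q X z by apply: qweyl_of_raises_l az lX rXYg.
have Yw : qweyl q Y w by apply: qweyl_of_raises_l aw lY rYXg.
have zY : qweyl q z Y by apply: qweyl_of_raises az lYg rYXl.
have wX : qweyl q w X by apply: qweyl_of_raises aw lXg rXYl.
(* The relations just proved tell how [z] and [w] move the remaining flags; this gives the last two
   quadratic relations and the Serre relations for y^+. *)
have rzXg := qweyl_raises q0 qroot fXl fXg opX aX Xz.
have rwYg := qweyl_raises q0 qroot fYl fYg opY aY Yw.
have rwXl := qweyl_raises_l q0 qroot fXg fXl opX aX wX.
have rzYl := qweyl_raises_l q0 qroot fYg fYl opY aY zY.
have zk1 : qweyl q z k1 by apply: qweyl_of_raises_l ak1 lz rzXg.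
have wk0 : qweyl q w k0.
  by apply: qweyl_of_raises_l ak0 lw rwYg => //; apply: opposite_sym.
have k01 : (k0 \o k1 = \1)%VF := acts_inverse fYg (opposite_sym opgg) ak0 ak1.
have k10 : (k1 \o k0 = \1)%VF := acts_inverse fXg opgg ak1 ak0.
pose pair (f g : 'End(V)) := [ffun i : 'I_2 => if i == ord0 then f else g].
(* Here k_0 k_1 = 1, so centrality is immediate and the right-hand side k_0^-1 k_1^-1 is 1. *)
exists (MkUact (pair w z) (pair Y X) (pair k0 k1) (pair k1 k0)).
rewrite /is_Umodule /= !ffunE /= k01 k10; split; last by [].
split.
- by apply: ord2P; rewrite !ffunE.
- by move=> i; rewrite !comp_lfun1l !comp_lfun1r.
- split; try by apply: ord2P; rewrite !ffunE.
  by apply: ord2P; apply: ord2P; rewrite // !ffunE.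
- apply: ord2P; apply: ord2P => // _; split.
  + by apply: (@serre_of_raises Xg Yl); rewrite ?ffunE.
  + by apply: (@serre_of_raises Yl Yg); rewrite ?ffunE.
  + by apply: (@serre_of_raises Yg Xl); rewrite ?ffunE.
  + by apply: (@serre_of_raises Xl Xg); rewrite ?ffunE.
Qed.

(** The central k_0 k_1 commutes with X and Y, so it preserves Xg and Yg. The relations with X and Y
    make k_1 lower Xg and k_0 lower Yg; dividing k_0 k_1 by one factor shows that the other
    preserves the second flag. Hence k_1 = [Xg,Yg] and k_0 = [Yg,Xg] are mutually inverse, k_0^-1
    k_1^-1 = 1, and two q-Weyl relations determine each y^+. *)
Lemma Umodule_acts u : is_Umodule q u -> ym u ord_max = X -> ym u ord0 = Y ->
  [/\ acts d (kk u ord_max) Xg Yg wt, acts d (kk u ord0) Yg Xg wt,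
      acts d (yp u ord_max) Yg Xl wt & acts d (yp u ord0) Xg Yl wt].
Proof.
move=> [inv cent [ypk kym ymyp ypym] _] uX uY.
have [k0i ik0] := inv ord0; have [k1i ik1] := inv ord_max.
have [_ cX _ _] := cent ord_max; have [_ cY _ _] := cent ord0.
rewrite uX in cX; rewrite uY in cY.
set k0 := kk u ord0 in k0i ik0 cX cY *; set k1 := kk u ord_max in k1i ik1 cX cY *.
have neq_iwt i j : (i < j)%N -> (wt i)^-1 != (wt j)^-1.
  by move=> ltij; rewrite (inj_eq invr_inj) wt_eq // ltn_eqF.
have scX i v := commute_stable (i := i) (v := v) fXg fXl (opposite_sym opX)
  (acts_swap q0 aX) neq_iwt cX.
have scY i v := commute_stable (i := i) (v := v) fYg fYl (opposite_sym opY)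
  (acts_swap q0 aY) neq_iwt cY.
have k1X : qweyl q k1 X by have := kym ord_max; rewrite uX.
have k0Y : qweyl q k0 Y by have := kym ord0; rewrite uY.
have lk1 := qweyl_lowers_l q0 qroot fXg fXl opX aX k1X.
have lk0 := qweyl_lowers_l q0 qroot fYg fYl opY aY k0Y.
have sk1 i v : v \in Yg i -> k1 v \in Yg i.
  move=> Yv; have -> : k1 v = kinv u ord0 ((k0 \o k1)%VF v).
    by rewrite -comp_lfunE comp_lfunA ik0 comp_lfun1l.
  by apply: inverse_stable ik0 (fun w => lowers_stable (i := i) (v := w) fYg lk0) _; apply: scY.
have sk0 i v : v \in Xg i -> k0 v \in Xg i.
  move=> Xv; have -> : k0 v = (k0 \o k1)%VF (kinv u ord_max v).
    by rewrite -comp_lfunE -comp_lfunA k1i comp_lfun1r.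
  by apply: scX; apply: inverse_stable ik1 (fun w => lowers_stable (i := i) (v := w) fXg lk1) _.
have ak1 : acts d k1 Xg Yg wt by apply: lowers_acts lk1 sk1.
have ak0 : acts d k0 Yg Xg wt by apply: lowers_acts (opposite_sym opgg) lk0 sk0.
have k10 : (k1 \o k0 = \1)%VF := acts_inverse fXg opgg ak1 ak0.
have ii : (kinv u ord0 \o kinv u ord_max = \1)%VF.
  suff -> : kinv u ord0 = k1 by [].
  by rewrite -[LHS]comp_lfun1l -k10 -comp_lfunA k0i comp_lfun1r.
have Xz : qweyl q X (yp u ord_max) by have := ymyp ord_max; rewrite uX.
have Yw : qweyl q Y (yp u ord0) by have := ymyp ord0; rewrite uY.
have zY : qweyl q (yp u ord_max) Y by have := ypym ord_max ord0 isT; rewrite uY ii.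
have wX : qweyl q (yp u ord0) X by have := ypym ord0 ord_max isT; rewrite uX ii.
have lzX := qweyl_lowers q0 qroot fXl fXg opX aX Xz.
have lzY := qweyl_lowers_l q0 qroot fYg fYl opY aY zY.
have lwY := qweyl_lowers q0 qroot fYl fYg opY aY Yw.
have lwX := qweyl_lowers_l q0 qroot fXg fXl opX aX wX.
split=> //.
  by apply: (lowers_acts fYg opgl lzY) => i v; apply: (lowers_stable fXl lzX).
by apply: (lowers_acts fXg oplg lwX) => i v; apply: (lowers_stable fYl lwY).
Qed.

Lemma Umodule_unique u u' :
    is_Umodule q u -> ym u ord_max = X -> ym u ord0 = Y ->
    is_Umodule q u' -> ym u' ord_max = X -> ym u' ord0 = Y ->
  u = u'.
Proof.
move=> Uu uX uY Uu' uX' uY'.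
have [ak1 ak0 az aw] := Umodule_acts Uu uX uY.
have [ak1' ak0' az' aw'] := Umodule_acts Uu' uX' uY'.
have ek1 := acts_unique fXg opgg ak1 ak1'.
have ek0 := acts_unique fYg (opposite_sym opgg) ak0 ak0'.
have ez := acts_unique fYg opgl az az'.
have ew := acts_unique fXg oplg aw aw'.
have einv i : kk u i = kk u' i -> kinv u i = kinv u' i.
  case: Uu Uu' => inv _ _ _ [inv' _ _ _] ek.
  have [_ ik] := inv i; have [ki' _] := inv' i.
  by rewrite -[kinv u i]comp_lfun1r -ki' -ek comp_lfunA ik comp_lfun1l.
case: u u' {Uu Uu' ak1 ak0 az aw ak1' ak0' az' aw'} uX uY uX' uY' ek1 ek0 ez ew einv.
move=> yp1 ym1 k1 i1 [yp2 ym2 k2 i2] /= uX uY uX' uY' ek1 ek0 ez ew einv.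
by congr MkUact; apply/ffunP; apply: ord2P; rewrite ?uX ?uY //; apply: einv.
Qed.

End FourFlags.

(** * Flags built from eigenspaces in a standard ordering *)

Section EigenFlags.
Import passmx.
Variables (K : fieldType) (V : vectType K) (d : nat).
Implicit Types (A B : 'End(V)) (l : nat -> K).

Definition eigenflag A l i : {vspace V} := (\sum_(j < i) leigenspace A (l j))%VS.

Lemma memv_leigenspace A c v : (v \in leigenspace A c) = (A v == c *: v).
Proof. by rewrite memv_ker !lfun_simp subr_eq0. Qed.

Lemma sub_eigenflag A l i j : (j < i)%N -> (leigenspace A (l j) <= eigenflag A l i)%VS.
Proof. by move=> ltji; apply: (sumv_sup (Ordinal ltji)). Qed.

Lemma eigenflag_is_flag A l : Defs.diagonalizable A ->
    (forall c, leigenvalue A c -> exists2 j, (j < d.+1)%N & l j = c) ->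
  is_flag d (eigenflag A l).
Proof.
move=> [s diagA] spec; split; first by rewrite /eigenflag big_ord0.
  move=> i j leij; apply/subv_sumP => k _; apply: sub_eigenflag.
  exact: leq_trans leij.
apply/eqP; rewrite eqEsubv subvf -diagA /=.
elim/big_ind: _ => [|U W sU sW|c _]; first exact: sub0v.
  by rewrite subv_add sU.
have [->|nz] := eqVneq (leigenspace A c) 0%VS; first exact: sub0v.
by have [j ltj <-] := spec c nz; apply: sub_eigenflag.
Qed.

Lemma eigenflag_lowers A l : lowers A (eigenflag A l) l.
Proof.
move=> i v; rewrite {1}/eigenflag big_ord_recr /=.
move=> /memv_addP[f Ff [e /= + ->]]; rewrite memv_leigenspace => /eqP Ae.
rewrite linearD /= scalerDr opprD addrACA Ae subrr addr0 rpredB ?rpredZ //.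
case/memv_sumP: Ff => vs vsE ->; rewrite linear_sum rpred_sum //= => j _.
have := vsE j isT; rewrite memv_leigenspace => /eqP Av.
rewrite Av rpredZ //; apply: (subvP (sub_eigenflag A l (ltn_ord j))).
exact: vsE.
Qed.

Lemma eigenflag_raises A B l : is_flag d (eigenflag A l) ->
    (forall j, (j <= d)%N -> (B @: leigenspace A (l j) <= eigenflag A l j.+2)%VS) ->
  raises B (eigenflag A l).
Proof.
move=> fl tri i v /memv_sumP[vs vsE ->]; rewrite linear_sum rpred_sum //= => j _.
have [ltdi|leid] := ltnP d i; first by apply: flagT fl _; lia.
have ltj := ltn_ord j.
apply: (flag_le (i := j.+2) fl) => //; apply: (subvP (tri j _)); first by lia.
by apply: memv_img; apply: vsE.
Qed.

(** The flags are opposite because A has disjoint spectra on complementary steps; B raises both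
    because the tridiagonal condition survives reversal. Indices above d read the default 0 of [th],
    or d - i = 0, but enter only where the flags already fill the space. *)
Lemma eigenflags_of_standard A B (th : seq K) (F := eigenflag A (fun i => th`_i))
    (G := eigenflag A (fun i => th`_(d - i))) :
    Defs.diagonalizable A -> standard_ordering A B th -> size th = d.+1 ->
  [/\ is_flag d F, is_flag d G, opposite d F G, raises B F & raises B G] /\
  [/\ F 1%N != 0%VS, F d != fullv, G 1%N != 0%VS & G d != fullv].
Proof.
move=> diagA [uth ev all_ev tri] sz.
have fF : is_flag d F.
  apply: eigenflag_is_flag => // c /all_ev th_c.
  by exists (index c th); rewrite ?nth_index // -sz index_mem.
have fG : is_flag d G.
  apply: eigenflag_is_flag => // c /all_ev th_c.
  have : (index c th < d.+1)%N by rewrite -sz index_mem.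
  move=> lti; exists (d - index c th)%N; first by lia.
  by rewrite subKn ?nth_index.
have op : opposite d F G.
  have lF : lowers A F (fun i => th`_i) by apply: eigenflag_lowers.
  have lG : lowers A G (fun i => th`_(d - i)) by apply: eigenflag_lowers.
  have neq i j : (i + j < d)%N -> th`_i != th`_(d - j).
    by move=> ltij; rewrite nth_uniq ?sz //; lia.
  move=> i j ij; split; apply/eqP.
    rewrite -subv0; apply/subvP => v /memv_capP[Fv Gv].
    by rewrite memv0 (disjoint_spectra fF fG lF lG neq _ Fv Gv) // ij.
  rewrite eqEsubv subvf /=; case: (fF) => _ _ <-; apply/subv_sumP => k _.
  have ltk := ltn_ord k; have [ltki|leik] := ltnP k i.
    by apply: subv_trans (addvSl _ _); apply: (sub_eigenflag A (fun i => th`_i)).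
  have -> : nat_of_ord k = (d - (d - k))%N by lia.
  apply: subv_trans (addvSr _ _).
  by apply: (sub_eigenflag A (fun i => th`_(d - i))); lia.
have F1 : F 1%N != 0%VS.
  by rewrite /F /eigenflag big_ord1; apply: ev; rewrite sz.
have G1 : G 1%N != 0%VS.
  by rewrite /G /eigenflag big_ord1; apply: ev; rewrite sz subn0.
have Fd : F d != fullv.
  apply: contraNneq G1 => E; have [|<- _] := op d 1%N; first by rewrite addn1.
  by rewrite E capfv.
have Gd : G d != fullv.
  apply: contraNneq F1 => E; have [|<- _] := op 1%N d; first by rewrite add1n.
  by rewrite E capvf.
have espE j : (j <= d)%N -> esp A th j = leigenspace A th`_j.
  by rewrite /esp sz ltnS => ->.
have subF i j : (j < i)%N -> (esp A th j <= F i)%VS.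
  move=> ltji; rewrite /esp; case: ifP => _; last exact: sub0v.
  exact: (sub_eigenflag A (fun i => th`_i)).
have subG i j : (d - j < i)%N -> (esp A th j <= G i)%VS.
  move=> ltji; rewrite /esp sz; case: ifP => [ltj|_]; last exact: sub0v.
  have <- : (d - (d - j))%N = j by lia.
  exact: (sub_eigenflag A (fun i => th`_(d - i))).
do 2?split => //; apply: eigenflag_raises => // j lej; rewrite -espE ?leq_subr //.
  apply: subv_trans (tri j _) _; rewrite ?sz // !subv_add !subF ?andbT //=.
  by case: j lej => [|j] lej; [exact: sub0v | apply: subF; lia].
apply: subv_trans (tri (d - j)%N _) _; rewrite ?sz ?ltnS ?leq_subr //.
rewrite !subv_add !subG ?andbT //=; try lia.
rewrite /esp_prev; case E : (d - j)%N => [|m]; [exact: sub0v | apply: subG; lia].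
Qed.

Lemma lowers_scale F A l c nu : is_flag d F -> c != 0 -> lowers A F l ->
    (forall i, (i <= d)%N -> l i = c * nu i) ->
  lowers (c^-1 *: A) F nu.
Proof.
move=> fF c0 lA eqln i v Fv; have [ltdi|leid] := ltnP d i; first exact: flagT fF _.
have -> : (c^-1 *: A)%VF v - nu i *: v = c^-1 *: (A v - l i *: v).
  by rewrite scale_lfunE scalerBr scalerA eqln // mulKf.
by rewrite rpredZ //; apply: lA.
Qed.

Lemma raises_scale F A c : raises A F -> raises (c *: A) F.
Proof. by move=> rA i v Fv; rewrite scale_lfunE rpredZ // rA. Qed.

End EigenFlags.

(** * From a tridiagonal pair to the module structure *)

(** The conditions are listed separately so that the result applies to A, As, q and also to As, A,
    q^-1. *)
Lemma Umodule_of_TD (K : fieldType) (q : K) (q0 : q != 0)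
  (qroot : forall n, (0 < n)%N -> q ^+ n != 1)
  (V : vectType K) (A As : 'End(V)) (d : nat) (th ths : seq K) (a b : K) :
    Defs.diagonalizable A -> Defs.diagonalizable As ->
    (forall W : {vspace V}, (A @: W <= W)%VS -> (As @: W <= W)%VS ->
       W = 0%VS \/ W = fullv) ->
    standard_ordering A As th -> standard_ordering As A ths ->
    size th = d.+1 -> size ths = d.+1 -> a != 0 -> b != 0 ->
    (forall i, (i <= d)%N -> th`_i = a * weight q d i) ->
    (forall i, (i <= d)%N -> ths`_i = b * (weight q d i)^-1) ->
  exists! u : Uact V, is_Umodule q u /\ a *: ym u ord_max = A /\ b *: ym u ord0 = As.
Proof.
move=> dA dAs irr sA sAs sz szs a0 b0 thE thsE.
have irr' W : (As @: W <= W)%VS -> (A @: W <= W)%VS -> W = 0%VS \/ W = fullv.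
  by move=> ? ?; apply: irr.
have [[fXl fXg opX rXl rXg] [Xl1 Xld Xg1 Xgd]] := eigenflags_of_standard dA sA sz.
(* The eigenvalues of As are b times inverse weights, so the given order yields Yg and the reversed
   one Yl, contrary to the case of A. *)
have [[fYg fYl opY' rYg rYl] [Yg1 Ygd Yl1 Yld]] := eigenflags_of_standard dAs sAs szs.
have opY := opposite_sym opY'.
set Xl := eigenflag A _ in fXl opX rXl Xl1 Xld.
set Xg := eigenflag A _ in fXg opX rXg Xg1 Xgd.
set Yg := eigenflag As _ in fYg opY' opY rYg Yg1 Ygd.
set Yl := eigenflag As _ in fYl opY' opY rYl Yl1 Yld.
have lAXl : lowers A Xl _ := @eigenflag_lowers _ _ _ _.
have lAXg : lowers A Xg _ := @eigenflag_lowers _ _ _ _.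
have lAsYl : lowers As Yl _ := @eigenflag_lowers _ _ _ _.
have lAsYg : lowers As Yg _ := @eigenflag_lowers _ _ _ _.
(* A stabilises the steps of its own flags and raises those of As, and conversely; irreducibility
   then makes a flag of A and a flag of As opposite. *)
have opgg : opposite d Xg Yg.
  exact: irreducible_opposite fXg fYg lAsYg rYg lAXg rXg Xg1 Ygd irr'.
have opgl : opposite d Yg Xl.
  exact: irreducible_opposite fYg fXl lAXl rXl lAsYg rYg Yg1 Xld irr.
have oplg : opposite d Xg Yl.
  exact: irreducible_opposite fXg fYl lAsYl rYl lAXg rXg Xg1 Yld irr'.
pose X := a^-1 *: A; pose Y := b^-1 *: As.
have wtN i : (i <= d)%N -> weight q d (d - i) = (weight q d i)^-1.
  by move=> lei; apply: (wtC q0 (subnKC lei)).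
have lXl : lowers X Xl (weight q d) by apply: (lowers_scale fXl a0 lAXl).
have lXg : lowers X Xg (fun i => (weight q d i)^-1).
  by apply: (lowers_scale fXg a0 lAXg) => i lei; rewrite thE ?leq_subr ?wtN.
have lYg : lowers Y Yg (fun i => (weight q d i)^-1) by apply: (lowers_scale fYg b0 lAsYg).
have lYl : lowers Y Yl (weight q d).
  by apply: (lowers_scale fYl b0 lAsYl) => i lei; rewrite thsE ?leq_subr ?wtN ?invrK.
have aX : acts d X Xl Xg (weight q d).
  by apply: (lowers_acts fXl opX lXl) => i v; apply: (lowers_stable fXg lXg).
have aY : acts d Y Yl Yg (weight q d).
  by apply: (lowers_acts fYl opY lYl) => i v; apply: (lowers_stable fYg lYg).
have actE (u : Uact V) : a *: ym u ord_max = A /\ b *: ym u ord0 = As <->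
    ym u ord_max = X /\ ym u ord0 = Y.
  rewrite /X /Y; split=> [[<- <-]|[-> ->]]; rewrite !scalerA.
    by rewrite !mulVf // !scale1r.
  by rewrite !divff // !scale1r.
have [u [Uu uXY]] : exists u : Uact V, is_Umodule q u /\ ym u ord_max = X /\ ym u ord0 = Y.
  apply: (Umodule_exists q0 qroot fXl fXg fYl fYg aX aY) => //;
    exact: raises_scale.
exists u; split=> [|u' [Uu' /actE[uX' uY']]]; first by split=> //; apply/actE.
have [uX uY] := uXY.
apply: (Umodule_unique q0 qroot fXl fXg fYl fYg aX aY opX opY opgg opgl oplg) => //.
Qed.

(** * The symmetry between y^+ and y^-, and irreducibility *)

Definition flip_act (K : fieldType) (V : vectType K) (u : Uact V) : Uact V :=
  MkUact (ym u) (yp u) (kk u) (kinv u).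

Lemma flip_actK (K : fieldType) (V : vectType K) : involutive (@flip_act K V).
Proof. by case. Qed.

(** Passing to q^-1 fixes [3]_q and reverses the arguments of the q-bracket, so the relations of y^+
    with k and of k with y^- are exchanged; the mixed relation also swaps i and j. *)
Lemma flip_Umodule (K : fieldType) (q : K) (V : vectType K) (u : Uact V) :
  is_Umodule q u -> is_Umodule q^-1 (flip_act u).
Proof.
have q3V : q3 q^-1 = q3 q.
  by rewrite /q3 invrK -(opprB (q ^+ 3)) -(opprB q) invrN mulrNN.
move=> [inv cent [ypk kym ymyp ypym] ser]; split=> //=.
- by move=> i; have [] := cent i.
- by split=> [i|i|i|i j ij]; rewrite qbracketV // ypym // eq_sym.
- by move=> i j /ser[sp sm]; rewrite /serre q3V.
Qed.

Lemma weight_exprz (K : fieldType) (q : K) (d i : nat) : q != 0 ->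
  q ^ (2 * i%:Z - d%:Z) = weight q d i.
Proof. by move=> q0; rewrite expfzDr // -PoszM -exprnP -exprnN. Qed.

(** [b *: B] and [c *: C] stand for the tridiagonal pair: a submodule is stable under both, so
    irreducibility of the pair applies. *)
Lemma Uirreducible_of_gens (K : fieldType) (V : vectType K) (u : Uact V)
    (B C : 'End(V)) (b c : K) :
    (0 < \dim (fullv : {vspace V}))%N ->
    (forall W : {vspace V}, ((b *: B)%R @: W <= W)%VS -> ((c *: C)%R @: W <= W)%VS ->
       W = 0%VS \/ W = fullv) ->
    (forall W : {vspace V},
       (forall i, [/\ (yp u i @: W <= W)%VS, (ym u i @: W <= W)%VS,
                     (kk u i @: W <= W)%VS & (kinv u i @: W <= W)%VS]) ->
       (B @: W <= W)%VS /\ (C @: W <= W)%VS) ->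
  Uirreducible u.
Proof.
move=> dimV irr sub; split=> // W /sub[BW CW].
have scale (M : 'End(V)) k : (M @: W <= W)%VS -> ((k *: M)%R @: W <= W)%VS.
  move=> MW; apply/subvP => _ /memv_imgP[v Wv ->].
  by rewrite scale_lfunE rpredZ // (subvP MW) // memv_img.
by apply: irr; apply: scale.
Qed.

Theorem theorem3p3 (K : closedFieldType) (q : K)
  (hq0 : q != 0) (hq : forall n : nat, (0 < n)%N -> q ^+ n != 1)
  (V : vectType K) (hV : (0 < \dim (fullv : {vspace V}))%N)
  (A As : 'End(V)) (hTD : tridiagonal_pair A As)
  (d : nat) (th ths : seq K)
  (hth : standard_ordering A As th) (hths : standard_ordering As A ths)
  (hsz : size th = d.+1) (hszs : size ths = d.+1)
  (a as_ : K) (ha : a != 0) (has : as_ != 0)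
  (hthi : forall i : nat, (i <= d)%N -> th`_i = a * q ^ (2 * i%:Z - d%:Z))
  (hthsi : forall i : nat, (i <= d)%N -> ths`_i = as_ * q ^ (d%:Z - 2 * i%:Z)) :
  (exists! u : Uact V, is_Umodule q u /\
      a *: ym u ord_max = A /\ as_ *: ym u ord0 = As)
  /\ (exists! u : Uact V, is_Umodule q u /\
      a *: yp u ord0 = A /\ as_ *: yp u ord_max = As)
  /\ (forall u : Uact V, is_Umodule q u ->
        a *: ym u ord_max = A -> as_ *: ym u ord0 = As -> Uirreducible u)
  /\ (forall u : Uact V, is_Umodule q u ->
        a *: yp u ord0 = A -> as_ *: yp u ord_max = As -> Uirreducible u).
Proof.
have [dA dAs _ _ irr] := hTD.
have irr' W : (As @: W <= W)%VS -> (A @: W <= W)%VS -> W = 0%VS \/ W = fullv.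
  by move=> AsW AW; apply: irr.
have thE i : (i <= d)%N -> th`_i = a * weight q d i.
  by move=> lei; rewrite hthi // weight_exprz.
have thsE i : (i <= d)%N -> ths`_i = as_ * (weight q d i)^-1.
  by move=> lei; rewrite hthsi // -weight_exprz // invr_expz opprB.
split.
  exact: (Umodule_of_TD hq0 hq dA dAs irr hth hths hsz hszs ha has thE thsE).
split.
  have qV0 : q^-1 != 0 by rewrite invr_eq0.
  (* The entries of [ths] are [as_] times the weights for q^-1, so As takes the first place and is
     given by y^-_1; the flip turns y^-_1 and y^-_0 into y^+_1 and y^+_0. *)
  have [||u [[Uu [uAs uA]] u_uniq]] := Umodule_of_TD qV0 (qV_not_root hq) dAs dA irr'
      hths hth hszs hsz has ha (d := d).
  - by move=> i lei; rewrite wtV thsE.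
  - by move=> i lei; rewrite wtV invrK thE.
  exists (flip_act u); split; first by split=> //; rewrite -[q]invrK; apply: flip_Umodule.
  move=> u' [Uu' [u'A u'As]]; rewrite (u_uniq (flip_act u')) ?flip_actK //.
  by split=> //; apply: flip_Umodule.
split=> u _ uA uAs.
  apply: (@Uirreducible_of_gens _ _ _ (ym u ord_max) (ym u ord0) a as_) => //.
    by rewrite uA uAs.
  by move=> W sub; have [_ ? _ _] := sub ord_max; have [_ ? _ _] := sub ord0.
apply: (@Uirreducible_of_gens _ _ _ (yp u ord0) (yp u ord_max) a as_) => //.
  by rewrite uA uAs.
by move=> W sub; have [? _ _ _] := sub ord_max; have [? _ _ _] := sub ord0.
Qed.
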